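(* Let $B$ be a finite connected left regular band and $\Bbbk$ a commutative ring with unit. Then the augmented simplicial chain complex $C_\bullet(\Delta(B);\Bbbk)\xrightarrow{\varepsilon}\Bbbk$ of the order complex of $B$ (with $B$ acting by left multiplication) is a projective resolution of the trivial $\Bbbk B$-module. More precisely, fixing $e_X$ with $Be_X=X$ for each $X\in\Lambda(B)$, $$C_q(\Delta(B);\Bbbk)\cong\bigoplus_{X\in\Lambda(B)} n_X\cdot\Bbbk L_X,$$ where $n_X$ is the number of $q$-simplices of $\Delta(e_XB)$ having $e_X$ as a vertex.
   Context: A left regular band is a finite semigroup $B$ with $x^2=x$, $xyx=xy$, partially ordered by $a\le b$ iff $ba=a$; left multiplication is order preserving, so $B$ acts on its order complex $\Delta(B)$ (simplices = nonempty chains) by simplicial maps, making the chain complex a complex of $\Bbbk B$-modules. $\Lambda(B)=\{Bb\}$ ordered by inclusion; $B_{\ge X}=\{b\mid Bb\supseteq X\}$; $B$ is connected if every $\Delta(B_{\ge X})$ is connected. The trivial module $\Bbbk$ has all $b$ acting as $1$. $L_X=\{b\mid Bb=X\}$ and $\Bbbk L_X$ is the free $\Bbbk$-module on $L_X$ with $a\cdot b=ab$ if $Ba\supseteq X$, $0$ otherwise. *)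

(* Defs.v *)
From HB Require Import structures.
(* Only ssralg is loaded: the structure declared below cannot be placed in the
   hierarchy once finGroupType, which it does not extend, has been loaded. *)
From mathcomp Require Import all_boot ssralg.

Set Implicit Arguments.
Unset Strict Implicit.
Unset Printing Implicit Defensive.

Import GRing.Theory.
Local Open Scope ring_scope.

(* The inhabitation axiom records the convention that a semigroup is nonempty:
   mathcomp's semigroupType allows an empty carrier. *)
HB.mixin Record Semigroup_isLeftRegularBand B of Semigroup B := {
  lrb_idem : forall x : B, (x * x = x)%g;
  lrb_xyx : forall x y : B, (x * y * x = x * y)%g;
  lrb_inhabited : exists x : B, x = x
}.

#[short(type="lrbType")]
HB.structure Definition LeftRegularBand :=
  { B of Finite B & Semigroup B & Semigroup_isLeftRegularBand B }.

Section LeftRegularBandDefs.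
Variable B : lrbType.
Implicit Types (a b : B) (A X : {set B}).

Definition lrb_le a b := (b * a)%g == a.
Definition lrb_lt a b := (a != b) && lrb_le a b.

Definition left_ideal b : {set B} := [set (x * b)%g | x : B].
Definition right_ideal b : {set B} := [set (b * x)%g | x : B].

Definition left_ideals : {set {set B}} := [set left_ideal b | b : B].

Definition upper_part X : {set B} := [set b | X \subset left_ideal b].

(* Adjacency in the 1-skeleton of the order complex of the subposet A; a
   simplicial complex is connected iff its 1-skeleton is. *)
Definition order_edge A : rel B :=
  [rel a b | [&& a \in A, b \in A & lrb_le a b || lrb_le b a]].

Definition order_complex_connected A : bool :=
  [forall a in A, forall b in A, connect (order_edge A) a b].

Definition lrb_connected : bool :=
  [forall X in left_ideals, order_complex_connected (upper_part X)].

(* A q-simplex of the order complex is a chain of q + 1 elements, listed in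
   increasing order; chains are thereby consistently oriented. *)
Definition simplex q := {t : q.+1.-tuple B | sorted lrb_lt t}.

Definition num_simplices_at q b : nat :=
  #|[set t : simplex q |
      (b \in val t) && all [in right_ideal b] (val t)]|.

End LeftRegularBandDefs.


Definition Lambda (B : lrbType) := {X : {set B} | X \in left_ideals B}.

HB.mixin Record LeftRegularBand_isConnected B of LeftRegularBand B := {
  lrb_connectedP : lrb_connected B
}.

#[short(type="connectedLrbType")]
HB.structure Definition ConnectedLeftRegularBand :=
  { B of LeftRegularBand B & LeftRegularBand_isConnected B }.

Section Linearization.
Variables (k : comPzRingType) (B : lrbType).

(* Bilinear extension of a partial action of B on a finite basis S to
   k^B x k^S -> k^S; act b s = None encodes the value 0. *)
Definition lin_act (S : finType) (act : B -> S -> option S)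
    (a : {ffun B -> k}) (f : {ffun S -> k}) : {ffun S -> k} :=
  [ffun t => \sum_b \sum_(s | act b s == Some t) a b * f s].

(* An element of the semigroup algebra is its family of coefficients; its ring
   structure (convolution) must not be confused with the pointwise one that
   {ffun B -> k} carries. *)
Definition semigroup_algebra := {ffun B -> k}.
HB.instance Definition _ := GRing.Zmodule.on semigroup_algebra.

Definition convolution (a b : semigroup_algebra) : semigroup_algebra :=
  lin_act (fun x y => Some (x * y)%g) a b.

Definition basis_elt (S : finType) (s : S) : {ffun S -> k} :=
  [ffun t => (t == s)%:R].

(* 1 - (1 - b_1) ... (1 - b_n), where b_1, ..., b_n are the elements of B. *)
Definition algebra_one : semigroup_algebra :=
  foldr (fun b e => basis_elt b + e - convolution (basis_elt b) e) 0 (enum B).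

Section Action.
Variables (S : finType) (act : B -> S -> option S).
Implicit Types (a b : semigroup_algebra) (f g : {ffun S -> k}).

Lemma lin_actDl a b f :
  lin_act act (a + b) f = lin_act act a f + lin_act act b f.
Proof.
apply/ffunP=> t; rewrite !ffunE -big_split; apply: eq_bigr => x _ /=.
by rewrite -big_split; apply: eq_bigr => s _; rewrite ffunE mulrDl.
Qed.

Lemma lin_actDr a f g :
  lin_act act a (f + g) = lin_act act a f + lin_act act a g.
Proof.
apply/ffunP=> t; rewrite !ffunE -big_split; apply: eq_bigr => x _ /=.
by rewrite -big_split; apply: eq_bigr => s _; rewrite ffunE mulrDr.
Qed.

Lemma lin_act_basislE x f t :
  lin_act act (basis_elt x) f t = \sum_(s | act x s == Some t) f s.
Proof.
rewrite ffunE (bigD1 x) //= [X in _ + X]big1 => [|y /negPf yx].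
  by rewrite addr0; apply: eq_bigr => s _; rewrite ffunE eqxx mul1r.
by rewrite big1 // => s _; rewrite ffunE yx mul0r.
Qed.

Lemma lin_act_basisrE a s t :
  lin_act act a (basis_elt s) t = \sum_(x | act x s == Some t) a x.
Proof.
rewrite ffunE [RHS]big_mkcond; apply: eq_bigr => x _ /=.
rewrite big_mkcond (bigD1 s) //= [X in _ + X]big1 => [|r /negPf rs].
  by rewrite addr0 ffunE eqxx mulr1.
by rewrite ffunE rs mulr0 if_same.
Qed.

Lemma lin_act_suml a f t :
  lin_act act a f t = \sum_x a x * lin_act act (basis_elt x) f t.
Proof.
rewrite ffunE; apply: eq_bigr => x _.
by rewrite lin_act_basislE mulr_sumr.
Qed.

Lemma lin_act_sumr a f t :
  lin_act act a f t = \sum_s lin_act act a (basis_elt s) t * f s.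
Proof.
rewrite ffunE (exchange_big_dep xpredT) //=; apply: eq_bigr => s _.
by rewrite lin_act_basisrE mulr_suml.
Qed.

Lemma lin_act_basis x s t :
  act x s = Some t -> lin_act act (basis_elt x) (basis_elt s) = basis_elt t.
Proof.
move=> xst; apply/ffunP=> r; rewrite lin_act_basislE big_mkcond (bigD1 s) //=.
rewrite big1 => [|u /negPf us]; last by rewrite ffunE us if_same.
rewrite xst addr0 !ffunE eqxx (inj_eq Some_inj) eq_sym.
by case: eqP.
Qed.

Hypothesis actM : forall x y s, act (x * y)%g s = obind (act x) (act y s).

Lemma lin_actA a b f :
  lin_act act a (lin_act act b f) = lin_act act (convolution a b) f.
Proof.
apply/ffunP=> t; rewrite !ffunE.
transitivity (\sum_x \sum_y \sum_(r | act (x * y)%g r == Some t)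
                 a x * b y * f r).
  apply: eq_bigr => x _.
  transitivity (\sum_(s | act x s == Some t) \sum_y
                  \sum_(r | act y r == Some s) a x * b y * f r).
    apply: eq_bigr => s _; rewrite ffunE mulr_sumr; apply: eq_bigr => y _.
    by rewrite mulr_sumr; apply: eq_bigr => r _; rewrite mulrA.
  rewrite exchange_big /=; apply: eq_bigr => y _.
  rewrite (exchange_big_dep xpredT) //= [RHS]big_mkcond; apply: eq_bigr => r _.
  rewrite actM; case: (act y r) => [s|] /=; last by rewrite big1 // => ? /andP[].
  case: ifP => xst; last first.
    by rewrite big1 // => u /andP[xu /eqP[su]]; rewrite su xu in xst.
  rewrite (bigD1 s) /=; last by rewrite xst eqxx.
  by rewrite big1 ?addr0 // => u /andP[/andP[_ /eqP[->]]]; rewrite eqxx.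
transitivity (\sum_z \sum_x \sum_(y | (x * y)%g == z)
                 \sum_(r | act z r == Some t) a x * b y * f r).
  rewrite [RHS]exchange_big; apply: eq_bigr => x _ /=.
  rewrite [RHS](exchange_big_dep xpredT) //=; apply: eq_bigr => y _.
  rewrite (eq_bigl (pred1 (x * y)%g)) ?big_pred1_eq //.
apply: eq_bigr => z _.
transitivity (\sum_(r | act z r == Some t) \sum_x \sum_(y | (x * y)%g == z)
                 a x * b y * f r).
  rewrite [RHS]exchange_big; apply: eq_bigr => x _ /=.
  by rewrite exchange_big.
by apply: eq_bigr => r _; rewrite ffunE mulr_suml; apply: eq_bigr => x _;
   rewrite mulr_suml.
Qed.

End Action.

Lemma convolutionA : associative convolution.
Proof.
by move=> a b c; apply: lin_actA => x y s /=; rewrite mulgA.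
Qed.

Lemma convolution_basis x y :
  convolution (basis_elt x) (basis_elt y) = basis_elt (x * y)%g.
Proof. exact: lin_act_basis. Qed.

End Linearization.

Section AlgebraUnit.
Variables (k : comPzRingType) (B : lrbType).
Local Notation kB := (semigroup_algebra k B).
Implicit Types a b : kB.

Lemma convolutionDl : left_distributive (@convolution k B) +%R.
Proof. by move=> a b c; apply: lin_actDl. Qed.

Lemma convolutionDr : right_distributive (@convolution k B) +%R.
Proof. by move=> a b c; apply: lin_actDr. Qed.

Lemma algebra_subE a b (x : B) : (a - b) x = a x - b x.
Proof. by rewrite [LHS]ffunE [in X in _ + X]ffunE. Qed.

Lemma convolution0 a : convolution a 0 = 0.
Proof. by apply: (addIr (convolution a 0)); rewrite -convolutionDr !add0r. Qed.

Lemma convolution0l a : convolution 0 a = 0.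
Proof. by apply: (addIr (convolution 0 a)); rewrite -convolutionDl !add0r. Qed.

Lemma convolutionN a b : convolution a (- b) = - convolution a b.
Proof.
by apply: (addIr (convolution a b)); rewrite -convolutionDr !addNr convolution0.
Qed.

Local Notation one := (algebra_one k B).

Lemma basis_convolution1 (c : B) :
  convolution (basis_elt k c) one = basis_elt k c.
Proof.
rewrite /algebra_one; have := mem_enum B c; rewrite inE.
elim: (enum _) c => //= b l IHl c; rewrite in_cons => cbl.
rewrite 2!convolutionDr convolutionN convolutionA !convolution_basis.
have [-> | cb] := eqVneq c b; first by rewrite lrb_idem addrK.
have cl : c \in l by rewrite (negPf cb) in cbl.
have cbe : convolution (basis_elt k (c * b)%g)
    (foldr (fun x e => basis_elt k x + e - convolution (basis_elt k x) e) 0 l) =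
    basis_elt k (c * b)%g.
  by rewrite -{1}lrb_xyx -convolution_basis -convolutionA IHl // convolution_basis lrb_xyx.
by rewrite cbe IHl // addrAC subrr add0r.
Qed.

Lemma convolution1 a : convolution a one = a.
Proof.
apply/ffunP=> t; rewrite /convolution lin_act_suml.
under eq_bigr => x _ do rewrite [lin_act _ _ _]basis_convolution1 ffunE.
rewrite (bigD1 t) //= eqxx mulr1 big1 ?addr0 // => x /negPf.
by rewrite eq_sym => ->; rewrite mulr0.
Qed.

End AlgebraUnit.

Section LeftRegularBandTheory.
Variable B : lrbType.
Implicit Types a b c x y : B.

Lemma in_left_ideal x b : (x \in left_ideal b) = ((x * b)%g == x).
Proof.
by apply/imsetP/eqP => [[y _ ->]|<-]; [rewrite -mulgA lrb_idem | exists x].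
Qed.

Lemma sub_left_ideal a b : (left_ideal a \subset left_ideal b) = ((a * b)%g == a).
Proof.
rewrite -in_left_ideal; apply/subsetP/idP => [|ab y].
  by apply; rewrite in_left_ideal lrb_idem.
rewrite !in_left_ideal => /eqP ya; move: ab; rewrite in_left_ideal => /eqP ab.
by rewrite -[in X in (X * b)%g]ya -mulgA ab ya.
Qed.

Lemma in_upper_part a b :
  (b \in upper_part (left_ideal a)) = ((a * b)%g == a).
Proof. by rewrite inE sub_left_ideal. Qed.

Lemma lrb_le_trans : transitive (@lrb_le B).
Proof. by move=> b a c /eqP ba /eqP cb; rewrite /lrb_le -ba mulgA cb. Qed.

Lemma lrb_le_last a s x :
  path (@lrb_le B) a s -> x \in a :: s -> lrb_le x (last a s).
Proof.
elim/last_ind: s => [|s b IHs] /=; first by rewrite inE /lrb_le => _ /eqP->; rewrite lrb_idem.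
rewrite rcons_path last_rcons -rcons_cons mem_rcons inE => /andP[/IHs le_s le_b].
case/predU1P=> [-> | /le_s le_x]; first by rewrite /lrb_le lrb_idem.
exact: lrb_le_trans le_x le_b.
Qed.

Lemma lrb_leM a b c : lrb_le b c -> lrb_le (a * b)%g (a * c)%g.
Proof. by move/eqP=> cb; rewrite /lrb_le !mulgA lrb_xyx -mulgA cb. Qed.

End LeftRegularBandTheory.

(* algebra_one is a right unit of the semigroup algebra of any left regular
   band; it is a left unit because the band is connected. *)
Section ConnectedUnit.
Variables (k : comPzRingType) (B : connectedLrbType).
Local Notation one := (algebra_one k B).

Let defect (b : B) : semigroup_algebra k B :=
  convolution one (basis_elt k b) - basis_elt k b.

Let defect_supp (b c : B) : (c * b)%g != c -> defect b c = 0.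
Proof.
move=> cb; rewrite /defect algebra_subE [basis_elt _ _ _]ffunE.
have /negPf-> : c != b by apply: contraNneq cb => ->; rewrite lrb_idem.
rewrite subr0 /convolution.
rewrite lin_act_basisrE big1 // => x /eqP[xb].
by rewrite -xb -mulgA lrb_idem eqxx in cb.
Qed.

Let defectM (b y c : B) :
    (c * y = c)%g ->
    (forall z, left_ideal c \proper left_ideal z -> defect b z = 0) ->
  defect (b * y)%g c = defect b c.
Proof.
move=> cy IHc.
have -> : defect (b * y)%g = convolution (defect b) (basis_elt k y).
  rewrite /defect convolutionDl -convolutionA convolution_basis; congr (_ + _).
  apply: (addrI (convolution (basis_elt k b) (basis_elt k y))).
  by rewrite -convolutionDl subrr convolution_basis subrr convolution0l.
rewrite /convolution lin_act_basisrE (bigD1 c) /= ?cy // big1 ?addr0 //.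
move=> z /andP[/eqP[zy] zc]; apply: IHc.
rewrite properE !sub_left_ideal -[in X in (X * z)%g]zy lrb_xyx zy eqxx /=.
by apply: contraNneq zc => <-; rewrite -[in X in (z * X)%g]zy mulgA lrb_idem zy.
Qed.

Let defect0 (b c : B) : defect b c = 0.
Proof.
have [m] := ubnP (#|B| - #|left_ideal c|).
elim: m => // m IHm in b c *; rewrite ltnS => le_m.
have{le_m} IHc b' z : left_ideal c \proper left_ideal z -> defect b' z = 0.
  move=> cz; apply: IHm; apply: leq_trans le_m.
  by apply: ltn_sub2l (proper_card cz); apply: leq_trans (proper_card cz) (max_card _).
have edge_eq x y : order_edge (upper_part (left_ideal c)) x y ->
    defect x c = defect y c.
  case/and3P; rewrite !in_upper_part => /eqP cx /eqP cy /orP[] /eqP <-.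
    by apply: defectM => // z; apply: IHc.
  by apply/esym/defectM => // z; apply: IHc.
have conn_eq x : (c * x = c)%g -> defect x c = defect c c.
  move=> cx; have /forall_inP/(_ (left_ideal c)) := @lrb_connectedP B.
  have cL : left_ideal c \in left_ideals B by apply: imset_f.
  move/(_ cL)/forall_inP/(_ x); rewrite in_upper_part cx eqxx => /(_ isT).
  move/forall_inP/(_ c); rewrite in_upper_part lrb_idem eqxx => /(_ isT).
  case/connectP=> p xp c_last.
  have -> : defect c c = defect (last x p) c by rewrite -c_last.
  elim: p x xp {cx c_last} => //= y p IHp x /andP[xy py].
  by rewrite (edge_eq _ _ xy); apply: IHp.
have sum0 : \sum_x one x * defect x c = 0.
  transitivity (convolution one one c - one c); last first.
    by rewrite convolution1 subrr.
  rewrite {1}/convolution lin_act_sumr.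
  have -> : one c = \sum_x one x * basis_elt k x c.
    rewrite (bigD1 c) //= ffunE eqxx mulr1 big1 ?addr0 // => x /negPf xc.
    by rewrite ffunE eq_sym xc mulr0.
  rewrite -sumrB; apply: eq_bigr => x _.
  by rewrite /defect algebra_subE mulrBr mulrC.
have sum1 : \sum_(x | (c * x)%g == c) one x = 1.
  have := congr1 (fun f : {ffun B -> k} => f c) (basis_convolution1 k c).
  by rewrite /convolution lin_act_basislE ffunE eqxx.
have cc0 : defect c c = 0.
  transitivity (\sum_(x | (c * x)%g == c) one x * defect c c).
    by rewrite -mulr_suml sum1 mul1r.
  rewrite -[RHS]sum0 [LHS]big_mkcond; apply: eq_bigr => x _ /=.
  case: eqP => [cx | /eqP cx]; first by rewrite (conn_eq _ cx).
  by rewrite (defect_supp cx) mulr0.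
by have [/conn_eq-> | /defect_supp] := eqVneq (c * b)%g c.
Qed.

Lemma convolution1l (a : semigroup_algebra k B) : convolution one a = a.
Proof.
apply/ffunP=> t; rewrite /convolution lin_act_sumr.
under eq_bigr => x _.
  have /eqP := defect0 x t; rewrite /defect algebra_subE subr_eq0 => /eqP.
  rewrite /convolution => ->; rewrite ffunE; over.
rewrite (bigD1 t) //= eqxx mul1r big1 ?addr0 // => x /negPf.
by rewrite eq_sym => ->; rewrite mul0r.
Qed.

End ConnectedUnit.

HB.instance Definition _ (k : comPzRingType) (B : connectedLrbType) :=
  GRing.Zmodule_isPzRing.Build (semigroup_algebra k B)
    (@convolutionA k B) (@convolution1l k B) (@convolution1 k B)
    (@convolutionDl k B) (@convolutionDr k B).

Section PermutationModules.
Variables (k : comPzRingType) (B : connectedLrbType).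
Local Notation kB := (semigroup_algebra k B).
Variables (S : finType) (act : B -> S -> option S).
Hypothesis actM : forall x y s, act (x * y)%g s = obind (act x) (act y s).
Hypothesis act_fix : forall s, exists x, act x s = Some s.

Lemma lin_act1 (f : {ffun S -> k}) : lin_act act (1 : kB) f = f.
Proof.
have act1 s : lin_act act (1 : kB) (basis_elt k s) = basis_elt k s.
  have [x xs] := act_fix s.
  rewrite -(lin_act_basis k xs) (lin_actA actM).
  by rewrite -[convolution _ _]/(1 * (basis_elt k x : kB)) mul1r.
apply/ffunP=> t; rewrite lin_act_sumr.
under eq_bigr => s _ do rewrite act1 ffunE.
rewrite (bigD1 t) //= eqxx mul1r big1 ?addr0 // => s /negPf.
by rewrite eq_sym => ->; rewrite mul0r.
Qed.

End PermutationModules.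

Section TrivialModule.
Variables (k : comPzRingType) (B : connectedLrbType).
Local Notation kB := (semigroup_algebra k B).

Definition trivial_module of connectedLrbType : Type := k.
HB.instance Definition _ := GRing.Zmodule.on (trivial_module B).

Definition trivial_scale (a : kB) (c : trivial_module B) : trivial_module B :=
  (\sum_b a b) * (c : k).

Lemma trivial_scaleA a b c :
  trivial_scale a (trivial_scale b c) = trivial_scale (a * b) c.
Proof.
rewrite /trivial_scale mulrA; congr (_ * _).
rewrite mulr_suml.
under [RHS]eq_bigr => z _ do rewrite ffunE.
rewrite [RHS]exchange_big; apply: eq_bigr => x _ /=.
rewrite (exchange_big_dep xpredT) //= mulr_sumr; apply: eq_bigr => y _.
by rewrite (big_pred1 (x * y)%g) // => z; rewrite eq_sym.
Qed.

Lemma trivial_scale1 : left_id 1 trivial_scale.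
Proof.
have [x _] := @lrb_inhabited B; move=> c.
have xc : trivial_scale (basis_elt k x) c = c.
  rewrite /trivial_scale (bigD1 x) //= ffunE eqxx big1 ?addr0 ?mul1r // => y.
  by rewrite ffunE => /negPf->.
by rewrite -[in LHS]xc trivial_scaleA mul1r xc.
Qed.

Lemma trivial_scaleDr : right_distributive trivial_scale +%R.
Proof. by move=> a c d; rewrite /trivial_scale mulrDr. Qed.

Lemma trivial_scaleDl c : {morph trivial_scale^~ c : a b / a + b}.
Proof.
move=> a b; rewrite /trivial_scale -mulrDl -big_split; congr (_ * _).
by apply: eq_bigr => x _; rewrite ffunE.
Qed.

HB.instance Definition _ :=
  GRing.Zmodule_isLmodule.Build kB (trivial_module B)
    trivial_scaleA trivial_scale1 trivial_scaleDr trivial_scaleDl.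

End TrivialModule.

Section SimplicialChains.
Variables (k : comPzRingType) (B : connectedLrbType).
Local Notation kB := (semigroup_algebra k B).

(* Left multiplication is a simplicial map: the induced chain map sends a
   simplex to its image, or to 0 if the image has lower dimension. *)
Definition simplex_act q (b : B) (t : simplex B q) : option (simplex B q) :=
  insub [tuple of map (fun x => (b * x)%g) (val t)].

Lemma simplex_actM q (x y : B) (t : simplex B q) :
  simplex_act (x * y)%g t = obind (simplex_act x) (simplex_act y t).
Proof.
rewrite /simplex_act; case: t => t t_lt /=.
have eq_xy : [tuple of map (fun z => (x * y * z)%g) t] =
    [tuple of map (fun z => (x * z)%g) [tuple of map (fun z => (y * z)%g) t]].
  by apply: val_inj; rewrite /= -map_comp; apply: eq_map => z /=; rewrite mulgA.
rewrite eq_xy; have [y_lt | y_nlt] := boolP (sorted (@lrb_lt B) (map (fun z => (y * z)%g) t)).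
  have -> := @insubT _ _ (simplex B q) [tuple of map (fun z => (y * z)%g) t] y_lt.
  by rewrite /=.
rewrite [X in obind _ X]insubN //= insubN //=.
apply: contra y_nlt; rewrite -map_comp !sorted_map => xy_lt.
suff: sorted [rel a b | lrb_lt a b && lrb_lt (x * (y * a))%g (x * (y * b))%g] t.
  apply: sub_sorted => a b /= /andP[/andP[_ le_ab] /andP[ne_xyab _]].
  rewrite /lrb_lt lrb_leM // andbT.
  by apply: contraNneq ne_xyab => ->.
by rewrite sorted_relI t_lt.
Qed.

Lemma simplex_act_fix q (t : simplex B q) : exists x, simplex_act x t = Some t.
Proof.
case: t => t t_lt; set top := last (thead t) (behead t).
exists top; rewrite /simplex_act /=.
suff eq_t : [tuple of map (fun z => (top * z)%g) t] = t.
  by rewrite eq_t insubT.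
apply: val_inj => /=; apply: map_id_in => z; rewrite /top {top}.
case/tupleP: t t_lt => a s; rewrite theadE /= => /(sub_path (e' := @lrb_le B)) le_s.
move=> z_s; apply/eqP/(lrb_le_last (le_s _)) => //.
by move=> b c /andP[].
Qed.

Definition chains q := {ffun simplex B q -> k}.
HB.instance Definition _ q := GRing.Zmodule.on (chains q).
HB.instance Definition _ q :=
  GRing.Zmodule_isLmodule.Build kB (chains q)
    (lin_actA (@simplex_actM q))
    (lin_act1 (@simplex_actM q) (@simplex_act_fix q))
    (lin_actDr (@simplex_act q))
    (fun f a b => lin_actDl (@simplex_act q) a b f).

Definition face (i : nat) (s : seq B) : seq B := take i s ++ drop i.+1 s.

Definition boundary q (f : chains q.+1) : chains q :=
  [ffun s : simplex B q =>
     \sum_(t : simplex B q.+1)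
       \sum_(i < q.+2 | face i (val t) == val s :> seq B) (-1) ^+ i * f t].

Definition augmentation (f : chains 0%N) : trivial_module k B := \sum_t f t.

End SimplicialChains.

Section FiberModule.
Variables (k : comPzRingType) (B : connectedLrbType).
Local Notation kB := (semigroup_algebra k B).

Definition fiber (X : Lambda B) := {b : B | left_ideal b == val X}.

Definition fiber_act X (b : B) (x : fiber X) : option (fiber X) :=
  if val X \subset left_ideal b then (insub (b * val x)%g : option (fiber X))
  else None.

Lemma fiber_subE X (x : fiber X) (b : B) :
  (val X \subset left_ideal b) = ((val x * b)%g == val x).
Proof. by rewrite -sub_left_ideal (eqP (valP x)). Qed.

Lemma fiber_actM X (a b : B) (x : fiber X) :
  fiber_act (a * b)%g x = obind (fiber_act a) (fiber_act b x).
Proof.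
rewrite /fiber_act !(fiber_subE x).
have [xb | nxb] := eqVneq (val x * b)%g (val x); last first.
  case: eqP => // xab; case/eqP: nxb.
  by rewrite -xab -!mulgA lrb_idem.
have bx_in : left_ideal (b * val x)%g == val X.
  apply/eqP; apply: etrans (eqP (valP x)); apply/eqP.
  rewrite eqEsubset !sub_left_ideal -mulgA lrb_idem eqxx /=.
  by rewrite mulgA lrb_xyx xb.
rewrite (insubT (fun y => left_ideal y == val X) bx_in) /=.
have -> : ((val x * (a * b))%g == val x) = ((val x * a)%g == val x).
  apply/eqP/eqP => [xab | xa]; last by rewrite mulgA xa xb.
  by rewrite -xab -mulgA lrb_xyx.
by rewrite mulgA.
Qed.

Lemma fiber_act_fix X (x : fiber X) : exists b, fiber_act b x = Some x.
Proof.
exists (val x); rewrite /fiber_act (fiber_subE x) lrb_idem eqxx.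
exact: valK.
Qed.

Definition fiber_module X := {ffun fiber X -> k}.
HB.instance Definition _ X := GRing.Zmodule.on (fiber_module X).
HB.instance Definition _ X :=
  GRing.Zmodule_isLmodule.Build kB (fiber_module X)
    (lin_actA (@fiber_actM X))
    (lin_act1 (@fiber_actM X) (@fiber_act_fix X))
    (lin_actDr (@fiber_act X))
    (fun f a b => lin_actDl (@fiber_act X) a b f).

End FiberModule.

Section DirectSum.
Variables (R : pzRingType) (I : finType) (M : I -> lmodType R).

Definition direct_sum := {dffun forall i, M i}.
HB.instance Definition _ := Choice.on direct_sum.

Implicit Types u v w : direct_sum.
Definition dsum_zero : direct_sum := [ffun i => 0].
Definition dsum_opp u : direct_sum := [ffun i => - u i].
Definition dsum_add u v : direct_sum := [ffun i => u i + v i].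
Definition dsum_scale (a : R) u : direct_sum := [ffun i => a *: u i].

Lemma dsum_addA : associative dsum_add.
Proof. by move=> u v w; apply/ffunP=> i; rewrite !ffunE addrA. Qed.
Lemma dsum_addC : commutative dsum_add.
Proof. by move=> u v; apply/ffunP=> i; rewrite !ffunE addrC. Qed.
Lemma dsum_add0 : left_id dsum_zero dsum_add.
Proof. by move=> u; apply/ffunP=> i; rewrite !ffunE add0r. Qed.
Lemma dsum_addN : left_inverse dsum_zero dsum_opp dsum_add.
Proof. by move=> u; apply/ffunP=> i; rewrite !ffunE addNr. Qed.

HB.instance Definition _ :=
  GRing.isZmodule.Build direct_sum dsum_addA dsum_addC dsum_add0 dsum_addN.

Lemma dsum_scaleA a b u : dsum_scale a (dsum_scale b u) = dsum_scale (a * b) u.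
Proof. by apply/ffunP=> i; rewrite !ffunE scalerA. Qed.
Lemma dsum_scale1 : left_id 1 dsum_scale.
Proof. by move=> u; apply/ffunP=> i; rewrite !ffunE scale1r. Qed.
Lemma dsum_scaleDr : right_distributive dsum_scale +%R.
Proof. by move=> a u v; apply/ffunP=> i; rewrite !ffunE scalerDr. Qed.
Lemma dsum_scaleDl u : {morph dsum_scale^~ u : a b / a + b}.
Proof. by move=> a b; apply/ffunP=> i; rewrite !ffunE scalerDl. Qed.

HB.instance Definition _ :=
  GRing.Zmodule_isLmodule.Build R direct_sum
    dsum_scaleA dsum_scale1 dsum_scaleDr dsum_scaleDl.

End DirectSum.

Section HomologicalAlgebra.
Variable R : pzRingType.

Definition lmod_isomorphic (U V : lmodType R) : Prop :=
  exists f : {linear U -> V}, bijective f.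

Definition projective (P : lmodType R) : Prop :=
  forall (M N : lmodType R) (p : {linear M -> N}) (f : {linear P -> N}),
    (forall y, exists x, p x = y) ->
    exists g : {linear P -> M}, forall x, p (g x) = f x.

Record projective_resolution (M : lmodType R) (C : nat -> lmodType R)
    (d : forall q, C q.+1 -> C q) (eps : C 0%N -> M) : Prop := {
  resolution_projective : forall q, projective (C q);
  resolution_d_linear : forall q, linear (d q);
  resolution_eps_linear : linear eps;
  resolution_surj : forall y, exists x, eps x = y;
  resolution_exact0 : forall x, eps x = 0 <-> exists y, d 0%N y = x;
  resolution_exactS : forall q x, d q x = 0 <-> exists y, d q.+1 y = x
}.

End HomologicalAlgebra.

(* Main.v *)
From HB Require Import structures.
Require Import Defs.
From mathcomp Require Import all_boot ssralg.

(* Exactness: left multiplication by b sends the order complex into bB, which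
   has greatest element b, so coning with apex b makes the action of b on
   augmented chains null-homotopic; as 1 is a linear combination of elements of
   B, a cycle z = 1 z is a boundary.  Projectivity and decomposition: put
     eps_X = e_X - sum_(Y < X) e_X eps_Y
   in the semigroup algebra.  Then b eps_X = 0 unless X <= Bb, sum_X eps_X = 1,
   and eps_X [e_Y] = [e_X] or 0 in the module k L_Y according to whether X = Y.
   Hence x |-> x eps_X m is a linear map from k L_X to any module containing m,
   and these maps, with m a simplex of the order complex of e_X B having e_X as a
   vertex, assemble into an isomorphism, whose inverse sends a simplex t with
   greatest element x to x e_X in the copy of k L_X indexed by e_X t.  Replacing m
   by a lift of its image solves lifting problems. *)

Set Implicit Arguments.
Unset Strict Implicit.
Unset Printing Implicit Defensive.

Import GRing.Theory.
Local Open Scope ring_scope.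

(** * Exactness of the augmented chain complex *)

Section Coboundary.
Variables (k : comPzRingType) (B : connectedLrbType).
Implicit Types (phi psi : seq B -> k) (s : seq B).

(** The transpose of the boundary, on functions of all sequences. Splitting off the deletion of the
    head, the other deletions being taken in the tail with opposite sign, allows induction with
    [phi] general. *)
Fixpoint coboundary phi s : k :=
  if s is x :: s' then phi s' - coboundary (phi \o cons x) s' else 0.

Lemma coboundary_sum phi s :
  coboundary phi s = \sum_(i < size s) (-1) ^+ i * phi (face i s).
Proof.
elim: s phi => [|x s IHs] phi /=; first by rewrite big_ord0.
rewrite big_ord_recl /face /= drop0 expr0 mul1r IHs -sumrN; congr (_ + _).
by apply: eq_bigr => i _; rewrite exprS mulN1r mulNr.
Qed.

Lemma coboundary0 phi s : (forall u, phi u = 0) -> coboundary phi s = 0.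
Proof.
elim: s phi => //= x s IHs phi phi0.
by rewrite phi0 IHs ?subr0 // => u /=.
Qed.

Lemma coboundaryB phi psi s :
  coboundary (fun u => phi u - psi u) s = coboundary phi s - coboundary psi s.
Proof.
elim: s phi psi => [|x s IHs] phi psi /=; first by rewrite subr0.
by rewrite (IHs (phi \o cons x) (psi \o cons x)) !opprD addrACA.
Qed.

(** Unfolded at [x :: s], the two occurrences of [coboundary phi s] cancel and the double coboundary
    of [phi \o cons x] remains. *)
Lemma coboundaryK phi s : coboundary (coboundary phi) s = 0.
Proof.
elim: s phi => //= x s IHs phi.
by rewrite (coboundaryB phi) IHs subr0 subrr.
Qed.

Lemma coboundary_map (f : B -> B) phi s :
  coboundary phi (map f s) = coboundary (phi \o map f) s.
Proof. by elim: s phi => //= x s IHs phi; rewrite IHs. Qed.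

Lemma coboundary_rcons b phi s :
  coboundary phi (rcons s b) =
    coboundary (phi \o rcons^~ b) s + (-1) ^+ size s * phi s.
Proof.
elim: s phi => [|x s IHs] phi /=; first by rewrite subr0 add0r mul1r.
by rewrite IHs opprD addrA exprS mulN1r mulNr.
Qed.

(** A weakly increasing sequence is a chain iff adjacent entries differ, so on such sequences this
    is vanishing on degenerate simplices. *)
Definition normalized phi :=
  forall s, ~~ sorted [rel a b | a != b] s -> phi s = 0.

(** Deleting either of two equal adjacent entries gives the same sequence with opposite signs; every
    other face retains the repetition. *)
Lemma coboundary_normalized phi : normalized phi -> normalized (coboundary phi).
Proof.
move=> phi0 s; elim: s phi phi0 => //= x s IHs phi phi0 xs.
have phix0 : normalized (phi \o cons x).
  move=> u /= nu; apply: phi0; apply: contra nu => /=.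
  exact: path_sorted.
have [s_ne | /[dup] s_nne /phi0->] :=
    boolP (sorted [rel a b | a != b] s); last first.
  by rewrite IHs // subr0.
case: s xs s_ne {IHs} => //= y s; rewrite negb_and negbK => xys ys.
have {xys} /eqP-> : x == y by case/orP: xys => //; rewrite ys.
rewrite coboundary0 ?subr0 ?subrr // => u /=.
by apply: phi0; rewrite /= eqxx.
Qed.

End Coboundary.

(** * Chains under left multiplication and coning *)

Section OrderTheory.
Variable B : lrbType.
Implicit Types (a b c : B) (s : seq B).

Lemma lrb_le_anti : antisymmetric (@lrb_le B).
Proof.
by move=> a b /andP[/eqP ba /eqP ab]; rewrite -ba -{1}ab lrb_xyx ab.
Qed.

Lemma lrb_lt_trans : transitive (@lrb_lt B).
Proof.
move=> b a c /andP[ab le_ab] /andP[bc le_bc].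
rewrite /lrb_lt (lrb_le_trans le_ab le_bc) andbT.
apply: contraNneq ab => ac; rewrite -ac in le_bc.
by apply/eqP/lrb_le_anti; rewrite le_ab.
Qed.

Lemma sorted_ltE s :
  sorted (@lrb_lt B) s = sorted [rel a b | a != b] s && sorted (@lrb_le B) s.
Proof. by rewrite -sorted_relI; apply: eq_sorted. Qed.

Lemma sorted_lt_le s : sorted (@lrb_lt B) s -> sorted (@lrb_le B) s.
Proof. by rewrite sorted_ltE => /andP[]. Qed.

Lemma sorted_le_map b s :
  sorted (@lrb_le B) s -> sorted (@lrb_le B) (map (fun x => (b * x)%g) s).
Proof. by rewrite sorted_map; apply: sub_sorted => x y; apply: lrb_leM. Qed.

Lemma sorted_lt_map b s : sorted (@lrb_le B) s ->
  sorted (@lrb_lt B) (map (fun x => (b * x)%g) s) -> sorted (@lrb_lt B) s.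
Proof.
move=> s_le; rewrite !sorted_ltE s_le andbT => /andP[+ _].
rewrite sorted_map; apply: sub_sorted => x y /=.
by apply: contraNneq => ->.
Qed.

Lemma sorted_le_cone b s : sorted (@lrb_le B) s ->
  sorted (@lrb_le B) (rcons (map (fun x => (b * x)%g) s) b).
Proof.
case: s => //= x s /(@sorted_le_map b (x :: s)) /= s_le.
by rewrite rcons_path s_le last_map /lrb_le mulgA lrb_idem eqxx.
Qed.

End OrderTheory.

(** * The cone homotopy, by duality with functions on sequences *)

Section Pairing.
Variables (k : comPzRingType) (B : connectedLrbType).
Implicit Types (phi psi : seq B -> k).
Local Notation lmul b := (map (fun x : B => (b * x)%g)).

(* Chain maps are computed by duality, against functions on all sequences. If
   such a function is normalized, a simplex degenerated by left multiplication
   contributes 0, in accordance with simplex_act. *)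
Definition pairing q (f : chains k B q) phi : k :=
  \sum_(t : simplex B q) f t * phi (val t).

Definition delta (s u : seq B) : k := (u == s)%:R.

Lemma delta_normalized q (t : simplex B q) : normalized (delta (val t)).
Proof.
move=> s ns; rewrite /delta; case: eqP => // st; case/negP: ns.
by rewrite st; have := valP t; rewrite sorted_ltE => /andP[].
Qed.

Lemma pairing_delta q (f : chains k B q) (t : simplex B q) :
  pairing f (delta (val t)) = f t.
Proof.
rewrite /pairing (bigD1 t) //= /delta eqxx mulr1 big1 ?addr0 // => s /negPf st.
by rewrite !(inj_eq val_inj) st mulr0.
Qed.

Lemma eq_pairing q (f : chains k B q) phi psi :
  (forall t : simplex B q, phi (val t) = psi (val t)) ->
  pairing f phi = pairing f psi.
Proof. by move=> eq_phi; apply: eq_bigr => t _; rewrite eq_phi. Qed.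

(** Faces of chains are chains, so each index [i] of [t] hits exactly one simplex, and exchanging
    the sums gives the transpose. *)
Lemma pairing_boundary q (f : chains k B q.+1) phi :
  pairing (boundary f) phi = pairing f (coboundary phi).
Proof.
rewrite /pairing; under eq_bigr => s _.
  rewrite ffunE mulr_suml; under eq_bigr => t _ do rewrite mulr_suml.
  over.
rewrite exchange_big; apply: eq_bigr => t _ /=.
rewrite (exchange_big_dep xpredT) //= coboundary_sum size_tuple mulr_sumr.
apply: eq_bigr => i _.
have sz : size (face i (val t)) == q.+1.
  rewrite size_cat size_take size_drop size_tuple ltn_ord.
  by rewrite subSS subnKC // -ltnS.
have st : sorted (@lrb_lt B) (Tuple sz).
  apply: (subseq_sorted (@lrb_lt_trans B)) (valP t); rewrite /= /face.
  rewrite -[X in subseq _ X](cat_take_drop i); apply: cat_subseq => //.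
  rewrite -[i.+1]add1n -drop_drop; exact: drop_subseq.
rewrite (big_pred1 (exist _ (Tuple sz) st : simplex B q)) /=.
  by rewrite mulrA [f t * _]mulrC.
move=> s; rewrite eq_sym -[RHS]val_eqE /=.
by rewrite -[RHS]val_eqE.
Qed.

(** An image of [t] discarded by [simplex_act] is still weakly increasing, so it has equal adjacent
    entries and [phi] vanishes on it. *)
Lemma pairing_scale q (a : semigroup_algebra k B) (f : chains k B q) phi :
  normalized phi ->
  pairing (a *: f) phi = \sum_b a b * pairing f (phi \o lmul b).
Proof.
move=> phi0; rewrite /pairing; under eq_bigr => s _.
  rewrite [(a *: f) s]ffunE mulr_suml.
  under eq_bigr => b _ do rewrite mulr_suml.
  over.
rewrite exchange_big; apply: eq_bigr => b _ /=.
rewrite (exchange_big_dep xpredT) //= mulr_sumr; apply: eq_bigr => t _.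
rewrite mulrA /simplex_act; case: insubP => [s s_lt s_val | n_lt].
  by rewrite (big_pred1 s) ?s_val // => u; rewrite (inj_eq Some_inj) eq_sym.
rewrite big1 // phi0 ?mulr0 //; apply: contra n_lt => ne.
by rewrite sorted_ltE ne sorted_le_map // sorted_lt_le // (valP t).
Qed.

(** Tested against [delta], this reduces to [coboundary_map]: left multiplication is compatible with
    the deletion of entries. *)
Lemma boundary_linear q : linear (@boundary k B q).
Proof.
move=> a f g; apply/ffunP=> s; rewrite -pairing_delta pairing_boundary.
have -> : pairing (a *: f + g) (coboundary (delta (val s))) =
    pairing (a *: f) (coboundary (delta (val s))) +
    pairing g (coboundary (delta (val s))).
  rewrite /pairing -big_split; apply: eq_bigr => t _.
  by rewrite [in LHS]ffunE mulrDl.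
rewrite -(pairing_boundary g) pairing_delta [RHS]ffunE; congr (_ + _).
rewrite pairing_scale; last exact/coboundary_normalized/delta_normalized.
rewrite -[RHS]pairing_delta pairing_scale; last exact: delta_normalized.
apply: eq_bigr => b _; rewrite pairing_boundary; congr (_ * _).
by apply: eq_pairing => t; rewrite /= coboundary_map.
Qed.

Lemma pairingDr q (f : chains k B q) phi psi :
  pairing f (fun s => phi s + psi s) = pairing f phi + pairing f psi.
Proof.
by rewrite /pairing -big_split; apply: eq_bigr => t _; rewrite mulrDr.
Qed.

Lemma pairingZr q (f : chains k B q) c phi :
  pairing f (fun s => c * phi s) = c * pairing f phi.
Proof.
by rewrite /pairing mulr_sumr; apply: eq_bigr => t _; rewrite mulrCA.
Qed.

(** The indicator of length 1 replaces the constant 1, which need not be normalized. *)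
Definition size1 (s : seq B) : k := (size s == 1%N)%:R.

Lemma size1_normalized : normalized size1.
Proof. by case=> [|x [|y s]] //= _; rewrite /size1. Qed.

Lemma augmentationE (f : chains k B 0) : augmentation f = pairing f size1.
Proof. by apply: eq_bigr => t _; rewrite /size1 size_tuple eqxx mulr1. Qed.

Lemma augmentation_linear : linear (@augmentation k B).
Proof.
move=> a f g; rewrite !augmentationE.
have -> : pairing (a *: f + g) size1 = pairing (a *: f) size1 + pairing g size1.
  rewrite /pairing -big_split; apply: eq_bigr => t _.
  by rewrite [in LHS]ffunE mulrDl.
congr (_ + _); rewrite (pairing_scale _ _ size1_normalized).
rewrite [RHS]mulr_suml; apply: eq_bigr => b _; congr (_ * _).
by apply: eq_pairing => t /=; rewrite /size1 size_map.
Qed.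

Lemma augmentation_surj (y : trivial_module k B) :
  exists x : chains k B 0, augmentation x = y.
Proof.
have [b _] := @lrb_inhabited B.
pose t : simplex B 0 := exist (fun t : 1.-tuple B => sorted _ t) [tuple b] isT.
exists [ffun s : simplex B 0 => if s == t then (y : k) else 0].
rewrite /augmentation (bigD1 t) //= ffunE eqxx big1 ?addr0 // => s /negPf st.
by rewrite ffunE st.
Qed.

Lemma augmentation_boundary (f : chains k B 1) : augmentation (boundary f) = 0.
Proof.
rewrite augmentationE pairing_boundary /pairing big1 // => t _.
have := size_tuple (val t); case: (tval (val t)) => [|x [|y [|z s]]] //= _.
by rewrite /size1 /= subr0 subrr mulr0.
Qed.

Lemma boundaryK q (f : chains k B q.+2) : boundary (boundary f) = 0.
Proof.
apply/ffunP=> s; rewrite -pairing_delta !pairing_boundary ffunE.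
by rewrite /pairing big1 // => t _; rewrite coboundaryK mulr0.
Qed.

(** The apex comes last because [b] is the greatest element of [bB]. A degenerate cone equals no
    simplex [s] and so contributes 0. *)
Definition cone q b (f : chains k B q) : chains k B q.+1 :=
  [ffun s : simplex B q.+1 =>
     pairing f (fun t => delta (val s) (rcons (lmul b t) b))].

Lemma pairing_cone q b (f : chains k B q) phi : normalized phi ->
  pairing (cone b f) phi = pairing f (fun t => phi (rcons (lmul b t) b)).
Proof.
move=> phi0; rewrite /pairing.
under eq_bigr => s _ do rewrite ffunE mulr_suml.
rewrite exchange_big; apply: eq_bigr => t _ /=.
under eq_bigr => s _ do rewrite -mulrA.
rewrite -mulr_sumr; congr (_ * _).
have sz : size (rcons (lmul b (val t)) b) == q.+2.
  by rewrite size_rcons size_map size_tuple.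
have le_s : sorted (@lrb_le B) (rcons (lmul b (val t)) b).
  exact/sorted_le_cone/sorted_lt_le/(valP t).
have [lt_s | nlt_s] := boolP (sorted (@lrb_lt B) (Tuple sz)).
  rewrite (bigD1 (exist _ (Tuple sz) lt_s : simplex B q.+1)) //= /delta eqxx.
  rewrite mul1r big1 ?addr0 // => s /negPf ns.
  by rewrite eq_sym [_ == _](inj_eq val_inj s (exist _ (Tuple sz) lt_s)) ns mul0r.
rewrite phi0 ?big1 // => [s _|]; last first.
  by apply: contra nlt_s => ne; rewrite sorted_ltE ne.
rewrite /delta; case: eqP => [s_val | _]; last by rewrite mul0r.
by case/negP: nlt_s; rewrite /= s_val; apply: (valP s).
Qed.

(* In dual form: cone b is a null-homotopy, up to sign, of the action of b. *)
Lemma pairing_boundary_cone q b (f : chains k B q) phi : normalized phi ->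
  pairing (boundary (cone b f)) phi =
    pairing f (coboundary (phi \o rcons^~ b) \o lmul b)
    + (-1) ^+ q.+1 * pairing f (phi \o lmul b).
Proof.
move=> phi0; rewrite pairing_boundary.
rewrite pairing_cone; last exact: coboundary_normalized.
rewrite -pairingZr -pairingDr; apply: eq_pairing => t /=.
by rewrite coboundary_rcons size_map size_tuple.
Qed.

Lemma chain_decomposition q (f : chains k B q) phi : normalized phi ->
  pairing f phi =
    \sum_b (1 : semigroup_algebra k B) b * pairing f (phi \o lmul b).
Proof. by move=> phi0; rewrite -pairing_scale // scale1r. Qed.

(** Weighted by the coefficients of the unit, the cone homotopies of the elements [b] add up to one
    for the identity; the sign cancels that of [pairing_boundary_cone]. *)
Definition contraction q (f : chains k B q) : chains k B q.+1 :=
  [ffun s : simplex B q.+1 => (-1) ^+ q.+1 *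
     \sum_b (1 : semigroup_algebra k B) b * cone b f s].

Lemma pairing_contraction q (f : chains k B q) phi :
  pairing (contraction f) phi =
    (-1) ^+ q.+1 *
      \sum_b (1 : semigroup_algebra k B) b * pairing (cone b f) phi.
Proof.
rewrite /pairing; under eq_bigr => s _ do rewrite ffunE -mulrA mulr_suml.
rewrite -mulr_sumr exchange_big; congr (_ * _); apply: eq_bigr => b _ /=.
by rewrite mulr_sumr; apply: eq_bigr => s _; rewrite mulrA.
Qed.

(** The hypothesis is a dual form of [f] being a cycle, uniform in the degree. It kills the first
    term of [pairing_boundary_cone] and leaves the action of 1. *)
Lemma boundary_contraction q (f : chains k B q) :
  (forall b phi, pairing f (coboundary (phi \o rcons^~ b) \o lmul b) = 0) ->
  boundary (contraction f) = f.
Proof.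
move=> f0; apply/ffunP=> s; rewrite -!pairing_delta pairing_boundary.
have norm_s := delta_normalized s.
rewrite pairing_contraction (chain_decomposition _ norm_s) mulr_sumr.
apply: eq_bigr => b _; rewrite -pairing_boundary pairing_boundary_cone //.
by rewrite f0 add0r mulrCA signrMK.
Qed.

Lemma chains_exact0 (f : chains k B 0) :
  augmentation f = 0 <-> exists y, boundary y = f.
Proof.
split=> [f0 | [y <-]]; last exact: augmentation_boundary.
exists (contraction f); apply: boundary_contraction => b phi.
(* Removing the only vertex of a 0-simplex leaves the apex alone, so the function is constant on
   0-simplices. *)
rewrite (@eq_pairing _ _ _ (fun s => phi [:: b] * size1 s)).
  by rewrite pairingZr -augmentationE f0 mulr0.
move=> t; rewrite /size1 size_tuple mulr1 /=.
have := size_tuple (val t); case: (tval (val t)) => [|x [|y s]] //= _.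
by rewrite subr0.
Qed.

Lemma chains_exactS q (f : chains k B q.+1) :
  boundary f = 0 <-> exists y, boundary y = f.
Proof.
split=> [f0 | [y <-]]; last exact: boundaryK.
exists (contraction f); apply: boundary_contraction => b phi.
rewrite (@eq_pairing _ _ _ (coboundary (phi \o rcons^~ b \o lmul b))).
  by rewrite -pairing_boundary f0 /pairing big1 // => t _; rewrite ffunE mul0r.
by move=> t; rewrite /= coboundary_map.
Qed.

End Pairing.

(** * A decomposition of the unit of the semigroup algebra *)

Section Scalars.
Variables (k : comPzRingType) (B : connectedLrbType).
Local Notation kB := (semigroup_algebra k B).
Implicit Types (c d : k) (a : kB) (b : B).

Definition elt b : kB := basis_elt k b.

Lemma eltM x y : elt x * elt y = elt (x * y)%g.
Proof. exact: convolution_basis. Qed.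

(** [k] acts on a [kB]-module through these multiples of the unit, which are central by
    [cst_comm]. *)
Definition cst c : kB := [ffun x : B => c * (1 : kB) x].

Lemma lin_act_cst (S : finType) (act : B -> S -> option S) c f :
  lin_act act (1 : kB) f = f -> lin_act act (cst c) f = [ffun s => c * f s].
Proof.
move=> act1; apply/ffunP=> t; rewrite lin_act_suml ffunE.
rewrite -[in RHS]act1 lin_act_suml.
by rewrite mulr_sumr; apply: eq_bigr => x _; rewrite ffunE mulrA.
Qed.

Lemma lin_act_elt (S : finType) (act : B -> S -> option S) b s :
  lin_act act (elt b) (basis_elt k s) = oapp (@basis_elt k S) 0 (act b s).
Proof.
case bs: (act b s) => [t|] /=; first exact: lin_act_basis.
apply/ffunP=> r; rewrite lin_act_basislE ffunE big1 // => u /eqP bu.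
by rewrite ffunE; case: eqP => // us; rewrite us bs in bu.
Qed.

Lemma sum_lin_act_cst (S : finType) (act : B -> S -> option S)
    (f : {ffun S -> k}) :
  (forall g, lin_act act (1 : kB) g = g) ->
  \sum_s lin_act act (cst (f s)) (basis_elt k s) = f.
Proof.
move=> act1; apply/ffunP=> t; rewrite sum_ffunE (bigD1 t) //=.
rewrite lin_act_cst // !ffunE eqxx mulr1 big1 ?addr0 // => s /negPf st.
by rewrite lin_act_cst // !ffunE eq_sym st mulr0.
Qed.

Lemma cst_mulE c a b : (cst c * a) b = c * a b.
Proof. by rewrite [cst c * a]lin_act_cst ?ffunE //; apply: convolution1l. Qed.

Lemma cst_comm c a : cst c * a = a * cst c.
Proof.
apply/ffunP=> t; rewrite cst_mulE -[in LHS](mulr1 a).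
rewrite ![(a * _) t]lin_act_sumr mulr_sumr; apply: eq_bigr => b _.
by rewrite [cst c b]ffunE mulrCA.
Qed.

Lemma cstD : {morph cst : c d / c + d}.
Proof. by move=> c d; apply/ffunP=> x; rewrite !ffunE mulrDl. Qed.

Lemma cst0 : cst 0 = 0.
Proof. by apply/ffunP=> x; rewrite !ffunE mul0r. Qed.

Lemma cst1 : cst 1 = 1.
Proof. by apply/ffunP=> x; rewrite !ffunE mul1r. Qed.

Lemma cstM : {morph cst : c d / c * d}.
Proof. by move=> c d; apply/ffunP=> x; rewrite cst_mulE !ffunE mulrA. Qed.

Lemma cst_sum (I : finType) (P : pred I) (F : I -> k) :
  cst (\sum_(i | P i) F i) = \sum_(i | P i) cst (F i).
Proof. exact: (big_morph cst cstD cst0). Qed.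

Lemma kB_decomposition a : a = \sum_b cst (a b) * elt b.
Proof.
apply/ffunP=> t; rewrite sum_ffunE (bigD1 t) //= cst_mulE ffunE eqxx mulr1.
rewrite big1 ?addr0 // => b; rewrite cst_mulE ffunE eq_sym => /negPf->.
by rewrite mulr0.
Qed.

Section Extension.
Variables (S : finType) (V : lmodType kB).
Implicit Types (f : {ffun S -> k}) (G : S -> V).

Definition lin_ext G f : V := \sum_s cst (f s) *: G s.

Lemma lin_extD G f g : lin_ext G (f + g) = lin_ext G f + lin_ext G g.
Proof.
rewrite /lin_ext -big_split; apply: eq_bigr => s _.
by rewrite ffunE cstD scalerDl.
Qed.

(** Equivariance for single elements of [B] on basis vectors, with [None] read as 0, extends
    bilinearly because scalars are central. The linearity of [fiber_coord] and [fiber_map] rests on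
    this. *)
Lemma lin_ext_act (act : B -> S -> option S) G (a : kB) f :
  (forall b s, elt b *: G s = oapp G 0 (act b s)) ->
  lin_ext G (lin_act act a f) = a *: lin_ext G f.
Proof.
move=> GM; rewrite [in RHS](kB_decomposition a) scaler_suml /lin_ext.
transitivity (\sum_t \sum_b \sum_(s | act b s == Some t)
                cst (a b * f s) *: G t).
  apply: eq_bigr => t _; rewrite ffunE cst_sum scaler_suml.
  by apply: eq_bigr => b _; rewrite cst_sum scaler_suml.
rewrite exchange_big; apply: eq_bigr => b _ /=.
rewrite (exchange_big_dep xpredT) //= scaler_sumr; apply: eq_bigr => s _.
rewrite scalerA -mulrA -cst_comm -scalerA -scalerA GM scalerA -cstM.
case: (act b s) => [t|] /=; last by rewrite big1 ?scaler0 // => ? /eqP.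
by rewrite (big_pred1 t) // => u; rewrite (inj_eq Some_inj) eq_sym.
Qed.

Lemma lin_ext_basis G s : lin_ext G (basis_elt k s) = G s.
Proof.
rewrite /lin_ext (bigD1 s) //= ffunE eqxx cst1 scale1r big1 ?addr0 // => t.
by rewrite ffunE => /negPf->; rewrite cst0 scale0r.
Qed.

Lemma eq_lin_ext G G' f : G =1 G' -> lin_ext G f = lin_ext G' f.
Proof. by move=> eqG; apply: eq_bigr => s _; rewrite eqG. Qed.

End Extension.

Lemma linear_lin_ext (S : finType) (V W : lmodType kB) (h : {linear V -> W})
    (G : S -> V) (f : {ffun S -> k}) :
  h (lin_ext G f) = lin_ext (h \o G) f.
Proof. by rewrite linear_sum; apply: eq_bigr => s _; rewrite linearZ. Qed.

End Scalars.

(** * The elements eps_X and their action on the fiber modules *)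

Section Idempotents.
Variables (k : comPzRingType) (B : connectedLrbType) (e : Lambda B -> B).
Hypothesis eP : forall X, left_ideal (e X) = val X.
Local Notation kB := (semigroup_algebra k B).
Local Notation elt := (@elt k B).
Implicit Types (X Y Z : Lambda B) (b c : B).

Lemma sub_idealE X b : (val X \subset left_ideal b) = ((e X * b)%g == e X).
Proof. by rewrite -eP sub_left_ideal. Qed.

(** This makes [b |-> Bb] a homomorphism to a meet semilattice. From [xbc = x] and [bcb = bc] one
    gets [xb = x]. *)
Lemma left_idealM b c : left_ideal (b * c)%g = left_ideal b :&: left_ideal c.
Proof.
apply/setP=> x; rewrite inE !in_left_ideal.
apply/eqP/andP=> [xbc | [/eqP xb /eqP xc]].
  by split; rewrite -xbc -!mulgA; [rewrite (mulgA b) lrb_xyx | rewrite lrb_idem].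
by rewrite mulgA xb xc.
Qed.

(* eps_X, by structural recursion on a bound n of #|X|. *)
Fixpoint idemp_rec n X : kB :=
  elt (e X) - \sum_(Y : Lambda B | val Y \proper val X)
    elt (e X) * (if n is m.+1 then idemp_rec m Y else 0).

Definition idemp X := idemp_rec #|val X| X.

(** Any bound at least [#|val X|] gives the same value, since proper inclusion lowers the
    cardinality. *)
Lemma idempE X : idemp X =
  elt (e X) - \sum_(Y : Lambda B | val Y \proper val X) elt (e X) * idemp Y.
Proof.
have stable n m Y : #|val Y| <= n -> #|val Y| <= m ->
    idemp_rec n Y = idemp_rec m Y.
  elim: n m Y => [|n IHn] [|m] Y leYn leYm //=; congr (_ - _);
    apply: eq_bigr => Z ZY.
  - by have := leq_trans (proper_card ZY) leYn.
  - by have := leq_trans (proper_card ZY) leYm.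
  congr (_ * _); apply: IHn; rewrite -ltnS.
    exact: leq_trans (proper_card ZY) leYn.
  exact: leq_trans (proper_card ZY) leYm.
rewrite /idemp (stable #|val X| #|val X|.+1 X) //=; congr (_ - _).
apply: eq_bigr => Y YX.
by congr (_ * _); apply: stable => //; apply/ltnW/proper_card.
Qed.

Lemma proper_ind (P : Lambda B -> Prop) :
  (forall X, (forall Y, val Y \proper val X -> P Y) -> P X) -> forall X, P X.
Proof.
move=> IH X; have [n] := ubnP #|val X|; elim: n X => // n IHn X leXn.
apply: IH => Y YX; apply: IHn; exact: leq_trans (proper_card YX) leXn.
Qed.

(** Inherited from [e_X b = e_X] through the recursion. In particular eps_X m depends only on e_X
    m. *)
Lemma idemp_eltr X b :
  val X \subset left_ideal b -> idemp X * elt b = idemp X.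
Proof.
elim/proper_ind: X => X IH Xb; rewrite idempE mulrBl eltM.
rewrite (eqP (_ : (e X * b)%g == e X)) -?sub_idealE //.
congr (_ - _); rewrite mulr_suml; apply: eq_bigr => Y YX.
by rewrite -mulrA IH // (subset_trans (proper_sub YX)).
Qed.

Lemma elt_idemp X : elt (e X) * idemp X = idemp X.
Proof.
rewrite idempE mulrBr eltM lrb_idem; congr (_ - _).
by rewrite mulr_sumr; apply: eq_bigr => Y _; rewrite mulrA eltM lrb_idem.
Qed.

(** For X = Bb one has [b e_X = b], so multiplying the recursion for eps_X by [b] on the left gives
    the sum. *)
Lemma elt_decomposition_sub b :
  elt b = \sum_(Y : Lambda B | val Y \subset left_ideal b) elt b * idemp Y.
Proof.
have bL : left_ideal b \in left_ideals B by apply: imset_f.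
pose X : Lambda B := Sub (left_ideal b) bL.
have beX : (b * e X = b)%g.
  by apply/eqP; rewrite -sub_left_ideal eP.
rewrite (bigD1 X) //= {1}idempE mulrBr eltM beX mulr_sumr.
rewrite [X in _ - X + _](_ : _ =
    \sum_(Y : Lambda B | val Y \proper val X) elt b * idemp Y).
  rewrite addrC addrCA.
  rewrite [X in X - _](eq_bigl (fun Y : Lambda B => val Y \proper val X)).
    by rewrite subrr addr0.
  by move=> Y; rewrite properEneq andbC -val_eqE.
by apply: eq_bigr => Y _; rewrite mulrA eltM beX.
Qed.

(** Since eps_X = e_X eps_X, one may replace [b] by [c = b e_X], whose ideal is properly contained
    in X. Then c eps_X is [c] minus the sum of c eps_Y over Y < X; by induction only Y inside Bc
    survive, and those sum to [c]. *)
Lemma elt_idemp0 X b :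
  ~~ (val X \subset left_ideal b) -> elt b * idemp X = 0.
Proof.
elim/proper_ind: X b => X IH b nXb.
rewrite -elt_idemp mulrA eltM.
set c := (b * e X)%g.
have cX : left_ideal c \proper val X.
  rewrite left_idealM eP properE subsetIr /=.
  by rewrite subsetI subxx andbT.
rewrite idempE mulrBr eltM -mulgA lrb_idem -/c mulr_sumr.
rewrite [in X in X - _]elt_decomposition_sub.
rewrite [X in _ - X](bigID (fun Y : Lambda B => val Y \subset left_ideal c)) /=.
rewrite [X in _ - (_ + X)]big1 ?addr0 => [|Y /andP[YX nYc]]; last first.
  by rewrite mulrA eltM -mulgA lrb_idem IH.
rewrite [X in _ - X](eq_big (fun Y : Lambda B => val Y \subset left_ideal c)
   (fun Y => elt c * idemp Y)) ?subrr // => [Y | Y _].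
  have [Yc | //] := boolP (_ \subset _); last by rewrite andbF.
  by rewrite andbT (sub_proper_trans Yc).
by rewrite mulrA eltM -mulgA lrb_idem.
Qed.

(** The form in which sum_X eps_X = 1 is used. *)
Lemma elt_decomposition b : elt b = \sum_(Y : Lambda B) elt b * idemp Y.
Proof.
rewrite [LHS]elt_decomposition_sub [LHS]big_mkcond; apply: eq_bigr => Y _ /=.
by case: ifPn => // /elt_idemp0->.
Qed.

Definition fiber_pt X : fiber X := Sub (e X) (introT eqP (eP X)).

Lemma elt_fiber b X (x : fiber X) :
  elt b *: (basis_elt k x : fiber_module k X) =
  oapp (fun y => basis_elt k y : fiber_module k X) 0 (fiber_act b x).
Proof. exact: lin_act_elt. Qed.

Lemma elt_fiber0 b X (v : fiber_module k X) :
  ~~ (val X \subset left_ideal b) -> elt b *: v = 0.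
Proof.
move=> nXb; apply/ffunP=> t; rewrite [LHS]lin_act_basislE ffunE big1 // => u.
by rewrite /fiber_act (negPf nXb).
Qed.

(** By induction the sum in eps_X contributes only its term Z = Y. That term cancels e_X [e_Y] when
    Y < X; it is absent when X = Y, and otherwise e_X already kills k L_Y. *)
Lemma idemp_fiber X Y :
  idemp X *: (basis_elt k (fiber_pt Y) : fiber_module k Y) =
  if X == Y then (basis_elt k (fiber_pt Y) : fiber_module k Y) else 0.
Proof.
elim/proper_ind: X => X IH; set v := (basis_elt k _ : fiber_module k Y) in IH *.
rewrite idempE scalerBl scaler_suml.
under eq_bigr => Z ZX do rewrite -scalerA IH //.
have [eqXY | neqXY] := eqVneq X Y.
  subst Y; rewrite [X in _ - X]big1 => [|Z ZX]; last first.
    by case: eqP ZX => [-> | _ _]; rewrite ?properxx ?scaler0.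
  rewrite subr0 /v elt_fiber /fiber_act eP subxx.
  by rewrite [(_ * _)%g](lrb_idem (val (fiber_pt X))) valK.
have [YX | nYX] := boolP (val Y \proper val X).
  rewrite (bigD1 Y) //= eqxx big1 ?addr0 ?subrr // => Z /andP[_ /negPf->].
  by rewrite scaler0.
rewrite [X in _ - X]big1 => [|Z ZX]; last first.
  by case: eqP ZX => [-> | _ _]; rewrite ?(negPf nYX) ?scaler0.
rewrite subr0 elt_fiber0 // eP; apply: contra nYX => YX.
by rewrite properEneq YX andbT (inj_eq val_inj) eq_sym.
Qed.

End Idempotents.

(** * Projectivity and decomposition of the chain modules *)

Section Decomposition.
Variables (k : comPzRingType) (B : connectedLrbType) (e : Lambda B -> B).
Hypothesis eP : forall X, left_ideal (e X) = val X.
Variable q : nat.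
Local Notation kB := (semigroup_algebra k B).
Local Notation elt := (@elt k B).
Local Notation idemp := (@idemp k B e).
Local Notation lmul b := (map (fun x : B => (b * x)%g)).
Implicit Types (X Y Z : Lambda B) (b c : B) (t : simplex B q).

Definition simplex_top t : B := tnth (val t) ord_max.

Lemma top_mul t x : x \in val t -> (simplex_top t * x)%g = x.
Proof.
move=> xt; apply/eqP; have := sorted_lt_le (valP t).
rewrite /simplex_top (tnth_nth x) -[nat_of_ord _]/q.+1.-1.
rewrite -[X in X.-1](size_tuple (val t)) nth_last.
case: (tval (val t)) (xt : x \in tval (val t)) => // a s xs /= le_s.
exact: lrb_le_last le_s xs.
Qed.

Lemma top_in t : simplex_top t \in val t.
Proof. exact: mem_tnth. Qed.

Lemma elt_mul_top t : simplex_act (simplex_top t) t = Some t.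
Proof.
rewrite /simplex_act -[RHS]valK; congr insub; apply: val_inj => /=.
by apply: map_id_in => x /top_mul.
Qed.

Lemma simplex_act_some b t s :
  simplex_act b t = Some s -> val s = [tuple of lmul b (val t)].
Proof. by rewrite /simplex_act; case: insubP => // u _ <- [<-]. Qed.

Lemma simplex_act_none b t :
  simplex_act b t = None -> ~~ sorted (@lrb_lt B) (lmul b (val t)).
Proof. by rewrite /simplex_act; case: insubP. Qed.

Lemma top_act b t s :
  simplex_act b t = Some s -> simplex_top s = (b * simplex_top t)%g.
Proof. by move=> bt; rewrite /simplex_top (simplex_act_some bt) tnth_map. Qed.

Lemma lmul_eM X b (s : seq B) : val X \subset left_ideal b ->
  lmul (e X) (lmul b s) = lmul (e X) s.
Proof.
rewrite (sub_idealE eP) => /eqP Xb; rewrite -map_comp; apply: eq_map => x /=.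
by rewrite mulgA Xb.
Qed.

Definition simplex_at X (i : 'I_(num_simplices_at q (e X))) : simplex B q :=
  enum_val i.

Definition fiber_gen X : fiber_module k X := basis_elt k (fiber_pt eP X).
Definition simplex_elt t : chains k B q := basis_elt k t.

Lemma elt_simplex b t :
  elt b *: simplex_elt t = oapp simplex_elt 0 (simplex_act b t).
Proof. exact: lin_act_elt. Qed.

(** Sequences are compared because e_X t may be degenerate, and then it matches no index. If the
    ideal of the top of [t] does not contain X, the action itself gives 0. *)
Definition coord_simplex X (i : 'I_(num_simplices_at q (e X))) t :
    fiber_module k X :=
  if lmul (e X) (val t) == val (simplex_at i) :> seq B
  then elt (simplex_top t) *: fiber_gen X else 0.

(** If X is not inside Bb, both sides vanish. Otherwise [e_X b = e_X], so [t] and [b t] have the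
    same image under e_X; if [b t] degenerates, so does e_X t, which then has no index. *)
Lemma coord_simplexM X (i : 'I_(num_simplices_at q (e X))) b t :
  elt b *: coord_simplex i t = oapp (coord_simplex i) 0 (simplex_act b t).
Proof.
rewrite /coord_simplex.
have [Xb | nXb] := boolP (val X \subset left_ideal b); last first.
  rewrite (elt_fiber0 _ nXb); case bt: (simplex_act b t) => [s|] //=.
  by rewrite (top_act bt) -eltM -scalerA (elt_fiber0 _ nXb) if_same.
case bt: (simplex_act b t) => [s|] /=.
  rewrite (top_act bt) (simplex_act_some bt) /= lmul_eM // -eltM -scalerA.
  by case: ifP; rewrite ?scaler0.
case: eqP => [t_i | _]; rewrite ?scaler0 //.
case/negP: (simplex_act_none bt); apply: (@sorted_lt_map _ (e X)).
  exact/sorted_le_map/sorted_lt_le/(valP t).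
by rewrite lmul_eM // t_i; apply: (valP (simplex_at i)).
Qed.

Definition fiber_coord X (i : 'I_(num_simplices_at q (e X))) (f : chains k B q) :
  fiber_module k X := lin_ext (coord_simplex i) f.

Lemma fiber_coord_linear X (i : 'I_(num_simplices_at q (e X))) :
  linear (fiber_coord i).
Proof.
move=> a f g; rewrite /fiber_coord lin_extD; congr (_ + _).
exact/lin_ext_act/coord_simplexM.
Qed.
HB.instance Definition _ X (i : 'I_(num_simplices_at q (e X))) :=
  GRing.isLinear.Build kB (chains k B q) (fiber_module k X) _
    (fiber_coord i) (fiber_coord_linear i).

Definition fiber_map (V : lmodType kB) X (m : V) (f : fiber_module k X) : V :=
  lin_ext (fun x : fiber X => (elt (val x) * idemp X) *: m) f.

(** Where [fiber_act] returns [None], the ideal of [b x] does not contain X, so [b x] kills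
    eps_X. *)
Lemma fiber_map_linear V X m : linear (@fiber_map V X m).
Proof.
move=> a f g; rewrite /fiber_map lin_extD; congr (_ + _).
apply: lin_ext_act => b x.
rewrite scalerA mulrA eltM /fiber_act; case: ifPn => [Xb | nXb]; last first.
  rewrite (elt_idemp0 k eP) ?scale0r // left_idealM subsetI negb_and.
  by rewrite nXb.
case: insubP => [y _ /= <- // | /eqP[]].
by rewrite left_idealM (eqP (valP x)) (setIidPr Xb).
Qed.
HB.instance Definition _ (V : lmodType kB) X (m : V) :=
  GRing.isLinear.Build kB (fiber_module k X) V _
    (fiber_map m) (@fiber_map_linear V X m).

Lemma linear_fiber_map (V W : lmodType kB) (h : {linear V -> W}) X (m : V)
    (f : fiber_module k X) :
  h (fiber_map m f) = fiber_map (h m) f.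
Proof.
by rewrite /fiber_map linear_lin_ext; apply: eq_lin_ext => x /=; rewrite linearZ.
Qed.

Lemma fiber_map_gen (V : lmodType kB) X (m : V) :
  fiber_map m (fiber_gen X) = idemp X *: m.
Proof. by rewrite /fiber_map lin_ext_basis /= (elt_idemp _ _). Qed.

Lemma simplex_at_in X (i : 'I_(num_simplices_at q (e X))) :
  (e X \in val (simplex_at i)) &&
    all [in right_ideal (e X)] (val (simplex_at i)).
Proof. by have := enum_valP i; rewrite inE. Qed.

Lemma simplex_at_exists X t :
    (e X \in val t) && all [in right_ideal (e X)] (val t) ->
  exists i : 'I_(num_simplices_at q (e X)), simplex_at i = t.
Proof.
move=> tX; have tA : t \in [set t : simplex B q |
    (e X \in val t) && all [in right_ideal (e X)] (val t)] by rewrite inE.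
by exists (enum_rank_in tA t); rewrite /simplex_at enum_rankK_in.
Qed.

Lemma simplex_at_inj X : injective (@simplex_at X).
Proof. exact: enum_val_inj. Qed.

Lemma right_idealE b x : x \in right_ideal b -> (b * x)%g = x.
Proof. by case/imsetP=> y _ ->; rewrite mulgA lrb_idem. Qed.

Lemma lmul_simplex_at X (i : 'I_(num_simplices_at q (e X))) :
  lmul (e X) (val (simplex_at i)) = val (simplex_at i).
Proof.
have /andP[_ /allP sX] := simplex_at_in i.
by apply: map_id_in => x /sX; apply: right_idealE.
Qed.

(** e_X is a vertex and is the greatest element of e_X B. *)
Lemma top_simplex_at X (i : 'I_(num_simplices_at q (e X))) :
  simplex_top (simplex_at i) = e X.
Proof.
have /andP[eXs /allP/(_ _ (top_in _))] := simplex_at_in i.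
move/right_idealE => eX_top; have top_eX := top_mul eXs.
by apply/lrb_le_anti; rewrite /lrb_le eX_top top_eX !eqxx.
Qed.

Lemma sum_fiber_map_coord_simplex X t :
  \sum_i fiber_map (simplex_elt (simplex_at i)) (@coord_simplex X i t) =
    (elt (simplex_top t) * idemp X) *: simplex_elt t.
Proof.
have injE i : fiber_map (simplex_elt (simplex_at i)) (@coord_simplex X i t) =
    if lmul (e X) (val t) == val (simplex_at i) :> seq B
    then (elt (simplex_top t) * idemp X) *: simplex_elt (simplex_at i) else 0.
  rewrite /coord_simplex; case: ifP; rewrite ?linear0 //.
  by rewrite linearZ /= fiber_map_gen scalerA.
have [Xt | nXt] := boolP (val X \subset left_ideal (simplex_top t)); last first.
  rewrite (elt_idemp0 k eP) ?scale0r // big1 // => i _; rewrite injE.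
  by rewrite (elt_idemp0 k eP) // scale0r if_same.
rewrite -[in RHS](idemp_eltr k eP (X := X) (b := e X)) ?eP //.
rewrite mulrA -[RHS]scalerA elt_simplex.
case Xt_s: (simplex_act (e X) t) => [s|] /=; last first.
  rewrite scaler0 big1 // => i _; rewrite injE; case: eqP => // t_i.
  case/negP: (simplex_act_none Xt_s); rewrite t_i.
  exact: (valP (simplex_at i)).
have s_val := simplex_act_some Xt_s.
(* The simplex e_X t lies in e_X B, and its top, e_X times the top of [t], is e_X because X lies
   inside the ideal of the top of [t]. *)
have [|i s_i] := @simplex_at_exists X s.
  rewrite s_val /=; apply/andP; split; last first.
    by apply/allP=> _ /mapP[x _ ->]; apply: imset_f.
  move: Xt; rewrite (sub_idealE eP) => /eqP Xt; rewrite -[X in X \in _]Xt.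
  exact/(map_f (fun x => (e X * x)%g))/top_in.
rewrite (bigD1 i) //= big1 ?addr0 => [|j /negPf ji].
  by rewrite injE s_i s_val eqxx.
rewrite injE; case: eqP => // t_j; case/eqP: ji; apply: simplex_at_inj.
by do 2!apply: val_inj; rewrite s_i s_val; apply/esym/t_j.
Qed.

Lemma chains_ext (f : chains k B q) : lin_ext simplex_elt f = f.
Proof.
exact: (sum_lin_act_cst (act := @simplex_act B q) _ (@scale1r _ (chains k B q))).
Qed.

Lemma fiber_ext X (f : fiber_module k X) :
  lin_ext (fun x => basis_elt k x : fiber_module k X) f = f.
Proof.
exact: (sum_lin_act_cst (act := @fiber_act B X) _
          (@scale1r _ (fiber_module k X))).
Qed.

(** Summed over X, the eps_X disappear by [elt_decomposition], and a simplex is fixed by its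
    greatest element. *)
Lemma sum_fiber_map_coord (f : chains k B q) :
  \sum_X \sum_i fiber_map (simplex_elt (simplex_at i)) (@fiber_coord X i f) = f.
Proof.
rewrite -[RHS]chains_ext.
transitivity (\sum_X \sum_t cst B (f t) *:
  \sum_i fiber_map (simplex_elt (simplex_at i)) (@coord_simplex X i t)).
  apply: eq_bigr => X _; under [RHS]eq_bigr => t _ do rewrite scaler_sumr.
  rewrite [RHS]exchange_big; apply: eq_bigr => i _ /=.
  by rewrite linear_sum; apply: eq_bigr => t _; rewrite linearZ.
rewrite exchange_big; apply: eq_bigr => t _ /=; rewrite -scaler_sumr.
under eq_bigr => X _ do rewrite sum_fiber_map_coord_simplex.
by rewrite -scaler_suml -(elt_decomposition k eP) elt_simplex elt_mul_top.
Qed.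

(** Naturality of [fiber_map] in [m] reduces the composite to the coordinate of one simplex, whose
    top is e_X. *)
Lemma fiber_coord_map X Y (i : 'I_(num_simplices_at q (e X)))
    (j : 'I_(num_simplices_at q (e Y))) (f : fiber_module k X) :
  fiber_coord j (fiber_map (simplex_elt (simplex_at i)) f) =
  fiber_map (if lmul (e Y) (val (simplex_at i)) == val (simplex_at j) :> seq B
       then elt (e X) *: fiber_gen Y else 0) f.
Proof.
rewrite linear_fiber_map /= /fiber_coord lin_ext_basis.
by rewrite /coord_simplex top_simplex_at.
Qed.

Lemma idemp_elt_gen X Y : idemp X *: (elt (e X) *: fiber_gen Y) =
  if X == Y then fiber_gen Y else 0.
Proof. by rewrite scalerA (idemp_eltr k eP) ?eP // idemp_fiber. Qed.

Lemma fiber_coord_map_neq X Y (i : 'I_(num_simplices_at q (e X)))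
    (j : 'I_(num_simplices_at q (e Y))) (f : fiber_module k X) : X != Y ->
  fiber_coord j (fiber_map (simplex_elt (simplex_at i)) f) = 0.
Proof.
move=> /negPf XY; rewrite fiber_coord_map /fiber_map /lin_ext big1 // => x _.
rewrite -scalerA.
by case: ifP; rewrite ?idemp_elt_gen ?XY !scaler0.
Qed.

(** e_X fixes the simplices indexed by X, so the coordinate is nonzero only if the indices agree;
    then [x e_X = x] recovers each basis vector. *)
Lemma fiber_coord_map_eq X (i j : 'I_(num_simplices_at q (e X)))
    (f : fiber_module k X) :
  fiber_coord j (fiber_map (simplex_elt (simplex_at i)) f) =
    if i == j then f else 0.
Proof.
rewrite fiber_coord_map lmul_simplex_at.
rewrite !(inj_eq val_inj) (inj_eq (@simplex_at_inj X)).
case: eqP => _; last first.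
  by rewrite /fiber_map /lin_ext big1 // => x _; rewrite !scaler0.
rewrite -[RHS]fiber_ext; apply: eq_lin_ext => x.
rewrite -scalerA idemp_elt_gen eqxx elt_fiber /fiber_act.
have xX : (val x * e X)%g = val x.
  by apply/eqP; rewrite -sub_left_ideal eP (eqP (valP x)).
by rewrite (eqP (valP x)) subxx [(_ * _)%g]xX valK.
Qed.

(** Arbitrary lifts of the images of the simplices at e_X suffice, since [fiber_map] is linear for
    every [m]; naturality then turns each lift into its image under [p]. *)
Lemma chains_projective : projective (chains k B q).
Proof.
move=> M N p f p_surj.
have p_surjb y : exists x, p x == y by have [x <-] := p_surj y; exists x.
pose m X (i : 'I_(num_simplices_at q (e X))) :=
  xchoose (p_surjb (f (simplex_elt (simplex_at i)))).
pose g (v : chains k B q) : M := \sum_X \sum_i fiber_map (@m X i) (fiber_coord i v).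
have g_lin : linear g.
  move=> a u v; rewrite scaler_sumr -big_split; apply: eq_bigr => X _ /=.
  rewrite scaler_sumr -big_split; apply: eq_bigr => i _ /=.
  by rewrite linearP linearP.
pose G : {linear chains k B q -> M} :=
  HB.pack g (GRing.isLinear.Build _ _ _ _ g g_lin).
exists G => v; rewrite -[in RHS](sum_fiber_map_coord v) !linear_sum.
apply: eq_bigr => X _; rewrite !linear_sum; apply: eq_bigr => i _.
by rewrite !linear_fiber_map (eqP (xchooseP (p_surjb _))).
Qed.

Lemma chains_isomorphic : lmod_isomorphic (chains k B q)
  (direct_sum (fun X : Lambda B =>
     {ffun 'I_(num_simplices_at q (e X)) -> fiber_module k X})).
Proof.
set D := direct_sum _.
pose F (v : chains k B q) : D := [ffun X => [ffun i => @fiber_coord X i v]].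
have F_lin : linear F.
  move=> a u v; apply/ffunP=> X; rewrite !ffunE; apply/ffunP=> i.
  by rewrite !ffunE linearP.
pose H : {linear chains k B q -> D} :=
  HB.pack F (GRing.isLinear.Build _ _ _ _ F F_lin).
pose G (u : D) : chains k B q :=
  \sum_X \sum_i fiber_map (simplex_elt (simplex_at i)) (u X i).
exists H; exists G => [v | u].
  rewrite -[RHS]sum_fiber_map_coord; apply: eq_bigr => X _; apply: eq_bigr => i _.
  by rewrite !ffunE.
apply/ffunP=> Y; apply/ffunP=> j; rewrite !ffunE linear_sum (bigD1 Y) //=.
rewrite [X in _ + X]big1 ?addr0 => [|X XY]; last first.
  by rewrite linear_sum big1 // => i _; apply: fiber_coord_map_neq.
rewrite linear_sum (bigD1 j) //= big1 ?addr0 => [|i /negPf ij].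
  by apply: etrans (fiber_coord_map_eq j j (u Y j)) _; rewrite eqxx.
by apply: etrans (fiber_coord_map_eq i j (u Y i)) _; rewrite ij.
Qed.

End Decomposition.

Theorem theorem5p11 (k : comPzRingType) (B : connectedLrbType) :
  projective_resolution (M := trivial_module k B) (C := chains k B)
    (@boundary k B) (@augmentation k B) /\
  forall e : Lambda B -> B, (forall X, left_ideal (e X) = val X) ->
    forall q, lmod_isomorphic (chains k B q)
      (direct_sum (fun X : Lambda B =>
         {ffun 'I_(num_simplices_at q (e X)) -> fiber_module k X})).
Proof.
split=> [|e eP q]; last exact: chains_isomorphic.
(* The resolution is stated without a choice of e_X, so one is made here for projectivity. *)
have gen (X : Lambda B) : exists b, left_ideal b == val X.
  by case/imsetP: (valP X) => b _ ->; exists b.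
split.
- by move=> q; apply: (chains_projective (fun X => eqP (xchooseP (gen X)))).
- exact: boundary_linear.
- exact: augmentation_linear.
- exact: augmentation_surj.
- exact: chains_exact0.
- exact: chains_exactS.
Qed.
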